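(* Let $0<q<1$, $M\ge1$, $\vec k=(k_1,\dots,k_M)$ with all $k_j>0$, $s,t>-1$, $v\in\mathbb{C}$ with $\mathrm{Re}(v)<1+s+t$, and $\vec x,\vec y\in(\mathbb{Z}_{\ge0})^M$. Then $$P_{\mathrm r}(\vec x,\vec y;s,t,v,\vec k;q)=\prod_{j=1}^MP_{\mathrm r}\big(x_j,y_j;\,h'_{j-1}(\vec x,s),\,h'_{j-1}(\vec y,t),\,v,\,k_j;\,q\big).$$
   Context: $q^z=e^{z\log q}$; $(\alpha;p)_n=\prod_{i=0}^{n-1}(1-\alpha p^i)$, $(\alpha_1,\dots,\alpha_m;p)_n=\prod_i(\alpha_i;p)_n$. For $k>0$ and $n,x,y\in\mathbb{Z}_{\ge0}$, $$\phi_{u,s}(n,x;k)=q^{n(s-u+\frac12k+\frac12)}\sum_{j=0}^{\min(n,x)}\frac{(q^{2n},\,q^{2x},\,q^{-2x-2s-2k};q^{-2})_j}{(q^{-2k},\,q^{-2};q^{-2})_j}q^{-2j},\qquad w_k(n)=q^{-n(k-1)}\frac{(q^{2k};q^2)_n}{(q^2;q^2)_n},$$ $$P_{\mathrm r}(x,y;s,t,v,k;q)=\sum_{n=0}^\infty\phi_{1,s}(n,x;k)\,\phi_{v,t}(n,y;k)\,w_k(n)\qquad(\mathrm{Re}(v)<1+s+t).$$ Height function: $h'_j(\vec y,t)=t+\sum_{i=1}^j(2y_i+k_i)$, $h'_0(\vec y,t)=t$. Multivariate functions: $$\Phi_{v,t}(\vec n,\vec y)=\prod_{j=1}^M\phi_{v,h'_{j-1}(\vec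 y,t)}(n_j,y_j;k_j),\qquad w_{\vec k}(\vec n)=\prod_{j=1}^Mw_{k_j}(n_j),$$ $$P_{\mathrm r}(\vec x,\vec y;s,t,v,\vec k;q)=\sum_{\vec n\in(\mathbb{Z}_{\ge0})^M}\Phi_{1,s}(\vec n,\vec x)\,\Phi_{v,t}(\vec n,\vec y)\,w_{\vec k}(\vec n).$$ *)

(* Defs.v *)
From HB Require Import structures.
From mathcomp Require Import all_boot all_order all_algebra finmap.
From mathcomp Require Import complex.
From mathcomp Require Import all_classical all_reals all_analysis.
From mathcomp.analysis.showcase Require Import summability.
Set Implicit Arguments.
Unset Strict Implicit.
Unset Printing Implicit Defensive.
Import Order.TTheory GRing.Theory Num.Theory.
Import numFieldNormedType.Exports.
Local Open Scope ring_scope.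
Local Open Scope complex_scope.
Local Open Scope classical_set_scope.

(* The topology of a numFieldType is found by inference only on a sort of such
   a structure, not on the bare carrier [R[i]]. *)
Definition Cplx (R : realType) : numFieldType := R[i].

Definition cexp {R : realType} (z : Cplx R) : Cplx R :=
  (expR (complex.Re z))%:C * (cos (complex.Im z) +i* sin (complex.Im z)).

Definition qpow {R : realType} (q : R) (z : Cplx R) : Cplx R :=
  cexp (z * (ln q)%:C).

Definition qpoch {F : numFieldType} (a p : F) (n : nat) : F :=
  \prod_(i < n) (1 - a * p ^+ i).

Definition qpochs {F : numFieldType} (s : seq F) (p : F) (n : nat) : F :=
  \prod_(a <- s) qpoch a p n.

Definition phi {R : realType} (q : R) (u : Cplx R) (s : R) (n x : nat) (k : R)
  : Cplx R :=
  qpow q (n%:R * (s%:C - u + (k / 2)%:C + (1 / 2)%:C)) *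
  \sum_(j < (minn n x).+1)
    qpochs [:: qpow q (2 *+ n); qpow q (2 *+ x);
               qpow q (- (2 *+ x) - 2 * s%:C - 2 * k%:C)] (qpow q (- 2)) j
    / qpochs [:: qpow q (- (2 * k%:C)); qpow q (- 2)] (qpow q (- 2)) j
    * qpow q (- (2 *+ j)).

Definition weight {R : realType} (q k : R) (n : nat) : Cplx R :=
  qpow q (- (n%:R * (k%:C - 1))) *
  (qpoch (qpow q (2 * k%:C)) (qpow q 2) n / qpoch (qpow q 2) (qpow q 2) n).

Definition Pr_term {R : realType} (q : R) (x y : nat) (s t : R) (v : Cplx R)
    (k : R) (n : nat) : Cplx R :=
  phi q 1 s n x k * phi q v t n y k * weight q k n.

Definition Pr {R : realType} (q : R) (x y : nat) (s t : R) (v : Cplx R)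
    (k : R) : Cplx R :=
  limn (series (Pr_term q x y s t v k)).

(* Indices are shifted to start at 0, so the factor of index [j : 'I_M] uses
   [height k y t j] where the 1-based formula has h'_(j-1). *)
Definition height {R : realType} {M : nat} (k : 'I_M -> R)
    (y : {ffun 'I_M -> nat}) (t : R) (j : nat) : R :=
  t + \sum_(i < M | (i < j)%N) ((2 * y i)%N%:R + k i).

Definition mphi {R : realType} {M : nat} (q : R) (k : 'I_M -> R) (v : Cplx R)
    (t : R) (n y : {ffun 'I_M -> nat}) : Cplx R :=
  \prod_(j < M) phi q v (height k y t j) (n j) (y j) (k j).

Definition mweight {R : realType} {M : nat} (q : R) (k : 'I_M -> R)
    (n : {ffun 'I_M -> nat}) : Cplx R :=
  \prod_(j < M) weight q (k j) (n j).

Definition mPr_term {R : realType} {M : nat} (q : R)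
    (x y : {ffun 'I_M -> nat}) (s t : R) (v : Cplx R) (k : 'I_M -> R)
    (n : {ffun 'I_M -> nat}) : Cplx R :=
  mphi q k 1 s n x * mphi q k v t n y * mweight q k n.

(* [summability.sum] is the limit of the finite partial sums along the filter
   of finite subsets of the index type, that is, unconditional summation. *)
Definition mPr {R : realType} {M : nat} (q : R)
    (x y : {ffun 'I_M -> nat}) (s t : R) (v : Cplx R) (k : 'I_M -> R)
  : Cplx R :=
  summability.sum (mPr_term q x y s t v k).

(* Main.v *)
(* For fixed [x], [s], [k], the numerators [(q^(2n); q^(-2))_j] with [j <= n]
   lie in [0, 1], so [|phi_{u,s}(n, x; k)|] is at most a constant times
   [q^(n (s - Re u + k/2 + 1/2))]; the ratio of q-shifted factorials in the
   weight is bounded in [n].  Hence the terms of the one-variable series are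
   dominated by a geometric sequence of ratio [q^(1 + s + t - Re v) < 1].
   Heights only increase [s] and [t], so all factors converge absolutely, and
   the multivariate sum is the unconditional expansion of a finite product of
   absolutely convergent series. *)
Require Import Defs.
From HB Require Import structures.
From mathcomp Require Import all_boot all_order all_algebra finmap.
From mathcomp Require Import complex.
From mathcomp Require Import all_classical all_reals all_analysis.
From mathcomp Require Import ring lra.
From mathcomp.analysis.showcase Require Import summability.
Import Order.TTheory GRing.Theory Num.Theory.
Import numFieldNormedType.Exports.
Local Open Scope ring_scope.
Local Open Scope classical_set_scope.

Set Implicit Arguments.
Unset Strict Implicit.
Unset Printing Implicit Defensive.
Local Open Scope complex_scope.

(** * Finite boxes of multi-indices *)

Definition ffun_val (I : finType) (N : nat) (f : {ffun I -> 'I_N}) :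
  {ffun I -> nat} := [ffun i => val (f i)].

Lemma ffun_val_inj (I : finType) N : injective (@ffun_val I N).
Proof.
move=> f g /ffunP fg; apply/ffunP => i; apply/val_inj.
by have := fg i; rewrite !ffunE.
Qed.

(** Encoded as the image of a finite function type, so that sums over it reindex to the form
    produced by [bigA_distr_bigA]. *)
Definition box (I : finType) (N : nat) : {fset {ffun I -> nat}} :=
  [fset n in codom (@ffun_val I N)]%fset.

Lemma in_box (I : finType) N (n : {ffun I -> nat}) :
  (n \in box I N) = [forall i, (n i < N)%N].
Proof.
rewrite in_fset; apply/codomP/forallP => [[f ->] i|nN].
  by rewrite ffunE ltn_ord.
exists [ffun i => Ordinal (nN i)].
by apply/ffunP => i; rewrite !ffunE.
Qed.

Lemma sub_box (I : finType) N N' : (N <= N')%N -> (box I N `<=` box I N')%fset.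
Proof.
move=> NN'; apply/fsubsetP => n; rewrite !in_box => /forallP nN.
by apply/forallP => i; exact: leq_trans (nN i) NN'.
Qed.

(** Boxes are cofinal among finite sets: one more than the largest coordinate occurring in [A]
    bounds them all. *)
Lemma fset_sub_box (I : finType) (A : {fset {ffun I -> nat}}) N :
  exists2 N', (N <= N')%N & (A `<=` box I N')%fset.
Proof.
exists (maxn N (\max_(n : A) \max_i val n i).+1); first exact: leq_maxl.
apply/fsubsetP => n nA; rewrite in_box; apply/forallP => i.
rewrite leq_max ltnS; apply/orP; right.
apply: leq_trans (leq_bigmax [` nA]%fset).
exact: (leq_bigmax (F := fun i => n i)).
Qed.

Lemma prod_series_box (K : comNzRingType) (I : finType) (a : I -> nat -> K) N :
  \prod_i series (a i) N = \sum_(n <- box I N) \prod_i a i (n i).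
Proof.
have -> : \sum_(n <- box I N) \prod_i a i (n i)
    = \sum_(n <- codom (@ffun_val I N)) \prod_i a i (n i).
  apply/perm_big/uniq_perm; rewrite ?fset_uniq//.
    by rewrite /codom map_inj_uniq ?enum_uniq//; exact: ffun_val_inj.
  by move=> n; rewrite in_fset.
under eq_bigr do rewrite /series /= big_mkord.
rewrite bigA_distr_bigA /codom /image_mem big_map big_enum /=.
by apply: eq_bigr => f _; apply: eq_bigr => i _; rewrite ffunE.
Qed.

(** * Unconditional summation of product families *)

Lemma big_fset_sub (K : zmodType) (I : choiceType) (A B : {fset I})
    (F : I -> K) : (A `<=` B)%fset ->
  \sum_(i <- B) F i = \sum_(i <- A) F i + \sum_(i <- (B `\` A)%fset) F i.
Proof.
move=> AB; rewrite (big_fsetID _ (mem A)) /=; congr (_ + _).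
  congr bigop; congr (enum_fset _); apply/fsetP => i; rewrite !inE /=.
  by apply/andb_idl => /(fsubsetP AB).
by congr bigop; congr (enum_fset _); apply/fsetP => i; rewrite !inE andbC.
Qed.

Lemma partial_sumE (K : zmodType) (I : choiceType) (F : I -> K)
    (A : {fset I}) : partial_sum F A = \sum_(i <- A) F i.
Proof. by rewrite big_seq_fsetE. Qed.

(* Any finite set containing the box [n i < N] lies in a larger box
   [n i < N'], so the error is at most the difference of the two products of
   partial sums of absolute values. *)
Lemma cvg_partial_sum_prod (K : numFieldType) (I : finType)
    (a : I -> nat -> K) (S T : I -> K) :
  (forall i, series (a i) @ \oo --> S i) ->
  (forall i, series (fun n => `|a i n|) @ \oo --> T i) ->
  partial_sum (fun n : {ffun I -> nat} => \prod_i a i (n i)) @ totally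
    --> \prod_i S i.
Proof.
move=> aS aT.
have cvgS : (fun N => \prod_i series (a i) N) @ \oo --> \prod_i S i.
  by apply: cvg_big => //; exact: mul_continuous.
have cvgT : (fun N => \prod_i series (fun n => `|a i n|) N) @ \oo
    --> \prod_i T i.
  by apply: cvg_big => //; exact: mul_continuous.
apply/(@cvgrPdist_lt _ _ _ _ (@totally_filter _)) => e e0.
have e3 : 0 < e / 3 by rewrite divr_gt0.
have /cvgrPdist_lt/(_ _ e3)[N1 _ hS] := cvgS.
have /cvgrPdist_lt/(_ _ e3)[N2 _ hT] := cvgT.
pose N := maxn N1 N2.
exists (box I N) => //= A NA.
have [N' NN' AN'] := fset_sub_box A N.
have leN1 : (N1 <= N)%N by exact: leq_maxl.
have leN2 : (N2 <= N)%N by exact: leq_maxr.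
(* Over the box the sum is the product of partial sums, within [e / 3] of the limit; the part of [A]
   outside the box gets the remaining two thirds. *)
rewrite partial_sumE (big_fset_sub _ NA) -prod_series_box.
rewrite opprD addrA (le_lt_trans (ler_normB _ _))//.
have -> : e = e / 3 + (e / 3 + e / 3) by field.
rewrite ltrD ?hS//.
set TT := fun N => \prod_i series (fun n => `|a i n|) N.
have hTT : `|TT N' - TT N| < e / 3 + e / 3.
  rewrite -(subrKA (\prod_i T i)) (le_lt_trans (ler_normD _ _))//.
  rewrite ltrD//; last exact: hT.
  by rewrite distrC; apply: hT; exact: leq_trans leN2 NN'.
(* The order on [K] is only partial, so the difference must be shown real before it is compared with
   its norm. *)
apply: le_lt_trans hTT; apply: le_trans (real_ler_norm _); last first.
  by rewrite rpredB// ger0_real// prodr_ge0// => i _; exact: sumr_ge0.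
rewrite /TT !prod_series_box (big_fset_sub _ (sub_box I NN')) addrC addKr.
have sA : (A `\` box I N `<=` box I N' `\` box I N)%fset by exact: fsetSD.
rewrite (big_fset_sub _ sA) ler_wpDr//.
  by apply: sumr_ge0 => n _; exact: prodr_ge0.
rewrite (le_trans (ler_norm_sum _ _ _))// ler_sum// => n _.
by rewrite normr_prod.
Qed.

(** * Absolute convergence of complex series *)

Lemma cvg_real_complex (R : realType) (u : R^nat) (l : R) :
  u @ \oo --> l -> (fun n => (u n)%:C : Cplx R) @ \oo --> (l%:C : Cplx R).
Proof.
move=> ul; apply/cvgrPdist_lt => e e0.
(* A positive element of [R[i]] is real, so the tolerance descends to [R]. *)
have /complex_realP[r er] : e \is Num.real by exact: gtr0_real.
rewrite er ltcR in e0 *.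
have /cvgrPdist_lt/(_ _ e0) := ul; apply: filterS => n.
by rewrite -rmorphB normc_def /= expr0n addr0 sqrtr_sqr ltcR.
Qed.

Lemma is_cvg_series_complex (R : realType) (a : (Cplx R)^nat) :
  cvgn (series (fun n => complex.Re (a n))) ->
  cvgn (series (fun n => complex.Im (a n))) -> cvgn (series a).
Proof.
move=> /cvg_ex[l /cvg_real_complex lRe] /cvg_ex[m /cvg_real_complex lIm].
apply/cvg_ex; exists ((l%:C : Cplx R) + 'i%C * (m%:C : Cplx R)).
have -> : series a = (fun n => (series (fun n => complex.Re (a n)) n)%:C
    + 'i%C * (series (fun n => complex.Im (a n)) n)%:C).
  apply/funext => n; rewrite /series /= !rmorph_sum mulr_sumr -big_split /=.
  by apply: eq_bigr => i _; exact: complexE.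
exact: (@cvgD (Cplx R) (Cplx R) _ _ _ _ _ _ _ lRe
  (@cvgM (Cplx R) _ _ _ _ _ _ _ (cvg_cst _) lIm)).
Qed.

(** Real and imaginary parts are bounded by the modulus, so the real comparison test applies to
    both, and to the modulus itself. *)
Lemma is_cvg_dominated_series (R : realType) (a : (Cplx R)^nat) (b : R^nat) :
  (forall n, `|a n| <= ((b n)%:C : Cplx R)) -> cvgn (series b) ->
  cvgn (series a) /\ cvgn (series (fun n => `|a n|)).
Proof.
move=> ab cb.
pose c n := complex.Re `|a n|.
have cE n : `|a n| = (c n)%:C by rewrite /c normc_def.
have bc n : c n <= b n by rewrite -lecR -cE.
have c0 n : 0 <= c n by rewrite -ler0c -cE.
have ccvg : cvgn (series c).
  by apply: (series_le_cvg _ _ bc) => // n; exact: le_trans (bc n).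
have ac (f : Cplx R -> R) : (forall z, (`|f z|%:C : Cplx R) <= `|z|) ->
    cvgn (series (fun n => f (a n))).
  move=> fle; apply: normed_cvg; apply: (series_le_cvg _ c0 _ ccvg) => // n.
    exact: normr_ge0.
  by rewrite /= -lecR -cE; exact: fle.
split.
  apply: is_cvg_series_complex; apply: ac => z; first exact: normc_ge_Re.
  by rewrite normc_def lecR -sqrtr_sqr ler_wsqrtr// lerDr sqr_ge0.
move/cvg_ex: ccvg => [l /cvg_real_complex lc].
apply/cvg_ex; exists (l%:C : Cplx R).
suff -> : series (fun n => `|a n|) = (fun n => (series c n)%:C) by [].
by apply/funext => n; rewrite /series /= rmorph_sum; exact: eq_bigr.
Qed.

(** * Moduli of q-powers and q-shifted factorials *)

Lemma norm_qpow (R : realType) (q : R) (z : Cplx R) :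
  `|qpow q z| = ((expR (complex.Re z * ln q))%:C : Cplx R).
Proof.
rewrite /qpow /cexp normrM !normc_def /= cos2Dsin2 sqrtr1 mulr1 expr0n addr0.
rewrite sqrtr_sqr ger0_norm ?expR_ge0//.
by case: z => a b /=; rewrite mulr0 subr0.
Qed.

Lemma qpow_real (R : realType) (q r : R) :
  qpow q (r%:C) = ((expR (r * ln q))%:C : Cplx R).
Proof. by rewrite /qpow /cexp -rmorphM /= cos0 sin0 mulr1. Qed.

(** Each factor lies in [0, 1]. The hypothesis stops at [i < n] because the base may exceed 1, as
    [q^(-2)] does in [phi]. *)
Lemma norm_qpoch_le1 (R : realType) (c p : R) (n : nat) :
  (forall i, (i < n)%N -> 0 <= c * p ^+ i <= 1) ->
  `|qpoch (c%:C : Cplx R) p%:C n| <= 1.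
Proof.
move=> cp; rewrite /qpoch normr_prod; apply: Num.Theory.prodr_ile1 => i _.
have /andP[c0 c1] := cp i (ltn_ord i).
rewrite normr_ge0 -rmorphXn -rmorphM -(rmorph1 (real_complex R)) -rmorphB.
by rewrite ger0_norm ?lecR ?ler0c; lra.
Qed.

(* [1 / (1 - a) <= exp (a / (1 - a))] turns the product into a geometric
   sum. *)
Lemma norm_qpoch_inv_bound (R : realType) (p : R) : 0 < p < 1 ->
  exists C : R, forall n, `|(qpoch (p%:C : Cplx R) p%:C n)^-1| <= C%:C.
Proof.
move=> /andP[p0 p1]; exists (expR (p / (1 - p) / (1 - p))) => n.
have p1' : `|p| < 1 by rewrite gtr0_norm.
have d0 : 0 < 1 - p by rewrite subr_gt0.
have pi i : 0 < p ^+ i <= 1.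
  by rewrite exprn_gt0//= exprn_ile1// ltW.
have pi0 i : 0 < 1 - p * p ^+ i.
  by have /andP[] := pi i; nra.
have -> : `|(qpoch (p%:C : Cplx R) p%:C n)^-1|
    = (\prod_(i < n) (1 - p * p ^+ i)^-1)%:C.
  rewrite normfV /qpoch normr_prod prodfV fmorphV rmorph_prod; congr (_^-1).
  apply: eq_bigr => i _.
  rewrite -rmorphXn -rmorphM -(rmorph1 (real_complex R)) -rmorphB.
  by rewrite ger0_norm// ler0c ltW.
rewrite lecR; apply: (@le_trans _ _
    (expR (\sum_(0 <= i < n) p / (1 - p) * p ^+ i))); last first.
  rewrite ler_expR; apply: (geometric_le_lim n) => //.
  by rewrite divr_ge0 ?ltW.
rewrite big_mkord expR_sum; apply: ler_prod => i _.
rewrite invr_ge0 ltW//=; apply: le_trans (expR_ge1Dx _).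
have /andP[h0 h1] := pi i; have := pi0 i.
set x := p ^+ i in h0 h1 * => hx.
rewrite -[leLHS]mul1r ler_pdivrMr//.
rewrite -(ler_pM2r d0).
(* The right-hand product equals [1 - p + p^2 x (1 - x)], which is at least [1 - p] since
   [0 < x <= 1]. *)
have -> : (1 + p / (1 - p) * x) * (1 - p * x) * (1 - p)
   = (1 - p + p * x) * (1 - p * x) by field; rewrite gt_eqF.
nra.
Qed.

(** * Geometric bounds for the one-variable terms *)

Lemma phi_bound (R : realType) (q : R) (u : Cplx R) (s k : R) (x : nat) :
  0 < q -> q < 1 -> exists C : R, forall n,
    `|phi q u s n x k|
    <= (C * expR ((s - complex.Re u + k / 2 + 1 / 2) * ln q) ^+ n)%:C.
Proof.
move=> q0 q1.
(* The part of the [j]-th summand free of [n]; only [(q^(2n); q^(-2))_j] is left out. *)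
pose D j : Cplx R := qpoch (qpow q (2 *+ x)) (qpow q (- 2)) j
  * qpoch (qpow q (- (2 *+ x) - 2 * s%:C - 2 * k%:C)) (qpow q (- 2)) j
  / qpochs [:: qpow q (- (2 * k%:C)); qpow q (- 2)] (qpow q (- 2)) j
  * qpow q (- (2 *+ j)).
have [d dE] : exists d : nat -> R, forall j, (d j)%:C = `|D j|.
  by exists (fun j => complex.Re `|D j|) => j; rewrite normc_def.
exists (\sum_(j < x.+1) d j) => n.
rewrite /phi normrM norm_qpow mulrC [leRHS]rmorphM /=; apply: ler_pM => //.
- by rewrite ler0c expR_ge0.
- rewrite rmorph_sum (le_trans (ler_norm_sum _ _ _))//=.
  under [leRHS]eq_bigr do rewrite dE.
  rewrite -!(big_mkord xpredT (fun j => `|D j|)).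
  have mx : (minn n x <= x)%N by exact: geq_minr.
  (* Nonnegative terms extend the range from [minn n x] to [x], which does not depend on [n]. *)
  rewrite (big_cat_nat _ (n := (minn n x).+1))//= big_mkord ler_wpDr//.
    exact: sumr_ge0.
  apply: ler_sum => j _.
  have jn : (j <= n)%N.
    by rewrite (leq_trans (ltn_ord j : (j <= minn n x)%N))// geq_minl.
  have -> : qpochs [:: qpow q (2 *+ n); qpow q (2 *+ x);
               qpow q (- (2 *+ x) - 2 * s%:C - 2 * k%:C)] (qpow q (- 2)) j
      / qpochs [:: qpow q (- (2 * k%:C)); qpow q (- 2)] (qpow q (- 2)) j
      * qpow q (- (2 *+ j)) = qpoch (qpow q (2 *+ n)) (qpow q (- 2)) j * D j.
    by rewrite /D {1}/qpochs !big_cons big_nil mulr1 -!mulrA.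
  (* The remaining factors are [1 - q^(2(n-i))] with [i < j <= n], hence in [0, 1]. *)
  rewrite normrM ler_piMl//.
  have -> : (2 *+ n : Cplx R) = (2 *+ n : R)%:C by rewrite rmorphMn rmorph_nat.
  have -> : (- 2 : Cplx R) = (- 2 : R)%:C by rewrite rmorphN rmorph_nat.
  rewrite !qpow_real; apply: norm_qpoch_le1 => i ij.
  rewrite -expRM_natl -expRD expR_ge0/= -[leRHS]expR0 ler_expR.
  have -> : 2 *+ n * ln q + i%:R * (-2 * ln q) = (n%:R - i%:R) * (2 * ln q).
    by rewrite -mulr_natr; ring.
  rewrite mulr_ge0_le0 ?subr_ge0 ?ler_nat ?(leq_trans (ltnW ij))//.
  by rewrite pmulr_rle0// ltW// ln_lt0// q0.
- rewrite lecR -expRM_natl ler_expR mulrA.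
  suff -> : complex.Re (n%:R * (s%:C - u + (k / 2)%:C + (1 / 2)%:C)) =
    n%:R * (s - complex.Re u + k / 2 + 1 / 2) by [].
  have -> : (n%:R : Cplx R) = (n%:R : R)%:C by rewrite rmorph_nat.
  by case: u => a b /=; rewrite mul0r subr0.
Qed.

(** The numerator [(q^(2k); q^2)_n] has modulus at most 1 and the inverse of the denominator is
    bounded uniformly in [n]; the prefactor gives the geometric part. *)
Lemma weight_bound (R : realType) (q k : R) : 0 < q -> q < 1 -> 0 < k ->
  exists C : R, forall n,
    `|weight q k n| <= (C * expR (- (k - 1) * ln q) ^+ n)%:C.
Proof.
move=> q0 q1 k0.
have lq : ln q < 0 by rewrite ln_lt0// q0.
have p01 : 0 < expR (2 * ln q) < 1.
  by rewrite expR_gt0/= -[ltRHS]expR0 ltr_expR; lra.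
have [C hC] := norm_qpoch_inv_bound p01.
exists C => n.
rewrite /weight normrM norm_qpow mulrC [leRHS]rmorphM; apply: ler_pM => //.
- by rewrite ler0c expR_ge0.
- have -> : (2 : Cplx R) = (2 : R)%:C by rewrite rmorph_nat.
  rewrite -rmorphM !qpow_real normrM -[leRHS]mul1r ler_pM//.
  apply: norm_qpoch_le1 => i _.
  rewrite -expRM_natl -expRD expR_ge0/= -[leRHS]expR0 ler_expR.
  have := ler0n R i; nra.
- rewrite lecR -expRM_natl ler_expR mulrA.
  have -> : (n%:R : Cplx R) = (n%:R : R)%:C by rewrite rmorph_nat.
  by rewrite -(rmorph1 (real_complex R)) -rmorphB -rmorphM /= mulrN.
Qed.

Lemma Pr_term_bound (R : realType) (q : R) (x y : nat) (s t : R) (v : Cplx R)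
    (k : R) : 0 < q -> q < 1 -> 0 < k ->
  exists C : R, forall n, `|Pr_term q x y s t v k n|
    <= (C * expR ((1 + s + t - complex.Re v) * ln q) ^+ n)%:C.
Proof.
move=> q0 q1 k0.
have [A hA] := phi_bound 1 s k x q0 q1.
have [B hB] := phi_bound v t k y q0 q1.
have [C hC] := weight_bound q0 q1 k0.
exists (A * B * C) => n; rewrite /Pr_term normrM [X in X * _]normrM.
have hAB := ler_pM (normr_ge0 _) (normr_ge0 _) (hA n) (hB n).
have AB0 : 0 <= `|phi q 1 s n x k| * `|phi q v t n y k| by exact: mulr_ge0.
apply: le_trans (ler_pM AB0 (normr_ge0 _) hAB (hC n)) _.
rewrite -!rmorphM lecR le_eqVlt; apply/orP; left; apply/eqP.
transitivity (A * B * C * (expR ((s - 1 + k / 2 + 1 / 2) * ln q)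
  * expR ((t - complex.Re v + k / 2 + 1 / 2) * ln q)
  * expR (- (k - 1) * ln q)) ^+ n); first by rewrite !exprMn /=; ring.
(* The two halves of [k] cancel against the weight, leaving the exponent [1 + s + t - Re v]. *)
by rewrite -!expRD; congr (_ * expR _ ^+ _); field.
Qed.

Lemma cvg_Pr_term (R : realType) (q : R) (x y : nat) (s t : R) (v : Cplx R)
    (k : R) : 0 < q -> q < 1 -> 0 < k -> complex.Re v < 1 + s + t ->
  cvgn (series (Pr_term q x y s t v k)) /\
  cvgn (series (fun n => `|Pr_term q x y s t v k n|)).
Proof.
move=> q0 q1 k0 hv; have [C hC] := Pr_term_bound x y s t v q0 q1 k0.
apply: (is_cvg_dominated_series hC); apply: is_cvg_geometric_series.
rewrite gtr0_norm ?expR_gt0// -[ltRHS]expR0 ltr_expR.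
by rewrite pmulr_rlt0 ?ln_lt0 ?q0//; lra.
Qed.

(** * Factorization of the multivariate sum *)

Lemma height_ge (R : realType) (M : nat) (k : 'I_M -> R)
    (y : {ffun 'I_M -> nat}) (t : R) (j : nat) :
  (forall i, 0 < k i) -> t <= height k y t j.
Proof.
by move=> k0; rewrite lerDl sumr_ge0// => i _; rewrite addr_ge0// ltW.
Qed.

(** Limits have a value even for divergent families, so the first two conjuncts certify that both
    sides of the identity are genuine sums. *)
Theorem corollary4p8 (R : realType) (q : R) (M : nat) (k : 'I_M -> R)
    (s t : R) (v : Cplx R) (x y : {ffun 'I_M -> nat})
    (hq0 : 0 < q) (hq1 : q < 1) (hM : (1 <= M)%N)
    (hk : forall j : 'I_M, 0 < k j)
    (hs : -1 < s) (ht : -1 < t) (hv : complex.Re v < 1 + s + t) :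
  [/\ forall j : 'I_M,
        cvgn (series (Pr_term q (x j) (y j) (height k x s j) (height k y t j)
                              v (k j))),
      cvg (partial_sum (mPr_term q x y s t v k) @ totally)
    & mPr q x y s t v k
      = \prod_(j < M) Pr q (x j) (y j) (height k x s j) (height k y t j)
                         v (k j)].
Proof.
pose a (j : 'I_M) :=
  Pr_term q (x j) (y j) (height k x s j) (height k y t j) v (k j).
have ca j : cvgn (series (a j)) /\ cvgn (series (fun n => `|a j n|)).
  apply: cvg_Pr_term => //.
  have := height_ge x s j hk; have := height_ge y t j hk; lra.
(* The heights depend on [x] and [y] but not on the summation index, so each term is a product of
   functions of one [n j] each. *)
have mPrE : mPr_term q x y s t v k = fun n => \prod_j a j (n j).
  by apply/funext => n; rewrite /mPr_term /mphi /mweight -!big_split.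
have cvgP : partial_sum (mPr_term q x y s t v k) @ totally
    --> \prod_j limn (series (a j)).
  rewrite mPrE.
  exact: (cvg_partial_sum_prod (fun j => (ca j).1) (fun j => (ca j).2)).
split; first by move=> j; exact: (ca j).1.
  by apply/cvg_ex; exists (\prod_j limn (series (a j))).
exact: (@cvg_lim _ _ _ _ (@totally_filter _) _ _ cvgP).
Qed.
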